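(* Let $\mathcal{M}=(\mathbb{R}^+\times\mathbb{R},\nabla)$ be a Type $\mathcal{B}$ surface model with $\dim\{\mathfrak{K}(\mathcal{M})\}=2$ which is not strongly projectively flat. Then $\dim\{E(-1,\nabla)\}=1$ if and only if $\mathcal{M}$ is linearly isomorphic to one of the following surfaces: (1) $C_{22}{}^1=0$, $C_{22}{}^2=C_{12}{}^1\neq0$. In this case $E(-1,\nabla)=\operatorname{Span}\{(x^1)^{C_{12}{}^2}\}$. (2) $C_{22}{}^1=\pm1$, $C_{12}{}^1=0$, $C_{22}{}^2=\pm2C_{11}{}^2\neq0$, $C_{11}{}^1=1+2C_{12}{}^2\pm(C_{11}{}^2)^2$ (same sign throughout). In this case $E(-1,\nabla)=\operatorname{Span}\{(x^1)^{\pm(C_{11}{}^2)^2+C_{12}{}^2}\}$ (with the same sign).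
   Context: For a torsion free connection $\nabla$ on a surface, with $\nabla_{\partial_{x^i}}\partial_{x^j}=\Gamma_{ij}{}^k\partial_{x^k}$, put $R(X,Y)=[\nabla_X,\nabla_Y]-\nabla_{[X,Y]}$, $\rho(X,Y)=\operatorname{Tr}\{Z\mapsto R(Z,X)Y\}$, and let $\rho_s$ be the symmetrization of $\rho$. The Hessian is $\mathcal{H}f=(\partial_{x^i}\partial_{x^j}f-\Gamma_{ij}{}^k\partial_{x^k}f)\,dx^i\otimes dx^j$, and for $\mu\in\mathbb{R}$, $E(\mu,\nabla)=\{f\in C^\infty: \mathcal{H}f=\mu f\rho_s\}$. $\mathfrak{K}(\mathcal{M})$ is the Lie algebra of affine Killing vector fields, i.e. vector fields $X$ with $\mathcal{L}_X\nabla=0$. $\nabla$ is strongly projectively flat if it is strongly projectively equivalent to a flat connection, i.e. locally $\nabla_XY=\nabla^0_XY+\omega(X)Y+\omega(Y)X$ with $\nabla^0$ flat torsion free and $\omega$ a closed 1-form; for surfaces this is equivalent to $\rho$ and $\nabla\rho$ being totally symmetric. A Type $\mathcal{B}$ surface model is $\mathbb{R}^+\times\mathbb{R}$ (coordinates $x^1>0$, $x^2$) with Christoffel symbols $\Gamma_{ij}{}^k=(x^1)^{-1}C_{ij}{}^k$, $C_{ij}{}^k=C_{ji}{}^k$ real constants. Two such models are linearly isomorphic if some map $(x^1,x^2)\mapsto(x^1,a\,x^1+b\,x^2)$ with $b\neq0$ intertwines the connections. *)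

(* Defs.v *)
From Stdlib Require Import Reals.
From Coquelicot Require Import Coquelicot.
Open Scope R_scope.

(** Tensor calculus in the global coordinates (x^1, x^2) of a planar domain.
    Functions are total on R * R; only their values on the domain matter, and
    every equality below is required on the domain only. *)

Inductive idx : Set := i1 | i2.

Definition sum2 (F : idx -> R) : R := F i1 + F i2.

Definition delta (i j : idx) : R :=
  match i, j with i1, i1 | i2, i2 => 1 | _, _ => 0 end.

Definition sfield := R -> R -> R.
Definition vfield := idx -> sfield.
(** [G i j k] is the Christoffel symbol with lower indices i, j and upper k. *)
Definition connection := idx -> idx -> idx -> sfield.

Definition pd (i : idx) (f : sfield) : sfield :=
  match i with
  | i1 => fun x y => Derive (fun t => f t y) x
  | i2 => fun x y => Derive (fun t => f x t) y
  end.

Definition half_plane (x y : R) : Prop := 0 < x.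

Definition open_set (U : R -> R -> Prop) : Prop :=
  forall x y, U x y -> locally_2d U x y.

Definition smooth_on (U : R -> R -> Prop) (f : sfield) : Prop :=
  forall (n : nat) x y, U x y -> ex_diff_n f n x y.

Definition smooth_vfield (U : R -> R -> Prop) (X : vfield) : Prop :=
  forall i, smooth_on U (X i).

Definition coord (i : idx) : vfield := fun j _ _ => delta i j.

Definition nabla (G : connection) (X Y : vfield) : vfield := fun k x y =>
  sum2 (fun i => X i x y *
    (pd i (Y k) x y + sum2 (fun j => G i j k x y * Y j x y))).

Definition bracket (X Y : vfield) : vfield := fun k x y =>
  sum2 (fun i => X i x y * pd i (Y k) x y - Y i x y * pd i (X k) x y).

Definition curv (G : connection) (X Y Z : vfield) : vfield := fun k x y =>
  nabla G X (nabla G Y Z) k x y - nabla G Y (nabla G X Z) k x y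
  - nabla G (bracket X Y) Z k x y.

Definition ricci (G : connection) (j k : idx) : sfield := fun x y =>
  sum2 (fun i => curv G (coord i) (coord j) (coord k) i x y).

Definition ricci_s (G : connection) (j k : idx) : sfield := fun x y =>
  (ricci G j k x y + ricci G k j x y) / 2.

Definition hessian (G : connection) (f : sfield) (i j : idx) : sfield :=
  fun x y => pd i (pd j f) x y - sum2 (fun k => G i j k x y * pd k f x y).

Definition E (mu : R) (G : connection) (f : sfield) : Prop :=
  smooth_on half_plane f /\
  forall i j x y, half_plane x y ->
    hessian G f i j x y = mu * f x y * ricci_s G i j x y.

(** [lie_nabla G X Y Z] is (L_X nabla)(Y, Z). *)
Definition lie_nabla (G : connection) (X Y Z : vfield) : vfield := fun k x y =>
  bracket X (nabla G Y Z) k x y - nabla G (bracket X Y) Z k x y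
  - nabla G Y (bracket X Z) k x y.

Definition killing (G : connection) (X : vfield) : Prop :=
  smooth_vfield half_plane X /\
  forall Y Z, smooth_vfield half_plane Y -> smooth_vfield half_plane Z ->
  forall k x y, half_plane x y -> lie_nabla G X Y Z k x y = 0.

Fixpoint lincomb {T : Type} (a : nat -> R) (b : nat -> T -> R) (n : nat)
    (p : T) : R :=
  match n with
  | O => 0
  | S m => lincomb a b m p + a m * b m p
  end.

(** [V] is a space of real functions on [D] (given by total functions on [T],
    two of which are identified when they agree on [D]); it has a basis with
    exactly [n] elements. *)
Definition has_dim {T : Type} (D : T -> Prop) (V : (T -> R) -> Prop) (n : nat) :
    Prop :=
  exists b : nat -> T -> R,
    (forall i, (i < n)%nat -> V (b i)) /\
    (forall a : nat -> R, (forall p, D p -> lincomb a b n p = 0) ->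
       forall i, (i < n)%nat -> a i = 0) /\
    (forall f, V f -> exists a : nat -> R, forall p, D p -> f p = lincomb a b n p).

Definition dim_E (mu : R) (G : connection) (n : nat) : Prop :=
  has_dim (fun p : R * R => half_plane (fst p) (snd p))
    (fun f => E mu G (fun x y => f (x, y))) n.

Definition dim_killing (G : connection) (n : nat) : Prop :=
  has_dim (fun p : idx * (R * R) => half_plane (fst (snd p)) (snd (snd p)))
    (fun X => killing G (fun k x y => X (k, (x, y)))) n.

Definition E_is_span (mu : R) (G : connection) (f : sfield) : Prop :=
  forall g : sfield,
    E mu G g <-> exists a : R, forall x y, half_plane x y -> g x y = a * f x y.

Definition torsion_free (U : R -> R -> Prop) (G : connection) : Prop :=
  forall i j k x y, U x y -> G i j k x y = G j i k x y.

Definition flat (U : R -> R -> Prop) (G : connection) : Prop :=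
  forall X Y Z, smooth_vfield U X -> smooth_vfield U Y -> smooth_vfield U Z ->
  forall k x y, U x y -> curv G X Y Z k x y = 0.

Definition closed_form (U : R -> R -> Prop) (w : idx -> sfield) : Prop :=
  forall i j x y, U x y -> pd i (w j) x y = pd j (w i) x y.

Definition apply_form (w : idx -> sfield) (X : vfield) : sfield := fun x y =>
  sum2 (fun i => w i x y * X i x y).

Definition strongly_projectively_flat (G : connection) : Prop :=
  forall x0 y0, half_plane x0 y0 ->
  exists (U : R -> R -> Prop) (G0 : connection) (w : idx -> sfield),
    U x0 y0 /\ open_set U /\ (forall x y, U x y -> half_plane x y) /\
    (forall i j k, smooth_on U (G0 i j k)) /\ torsion_free U G0 /\ flat U G0 /\
    (forall i, smooth_on U (w i)) /\ closed_form U w /\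
    (forall X Y, smooth_vfield U X -> smooth_vfield U Y ->
     forall k x y, U x y ->
       nabla G X Y k x y =
       nabla G0 X Y k x y + apply_form w X x y * Y k x y
       + apply_form w Y x y * X k x y).

(** Type B models, encoded by the constants c i j k = C_{ij}^k. *)

Definition coeffs := idx -> idx -> idx -> R.

Definition sym_coeffs (c : coeffs) : Prop := forall i j k, c i j k = c j i k.

Definition typeB (c : coeffs) : connection := fun i j k x _ => / x * c i j k.

(** The map (x^1, x^2) |-> (x^1, a x^1 + b x^2); for b <> 0 its inverse is
    (x^1, x^2) |-> (x^1, (x^2 - a x^1) / b). *)
Definition shear (a b : R) : idx -> sfield := fun k x y =>
  match k with i1 => x | i2 => a * x + b * y end.

Definition push (a b : R) (X : vfield) : vfield := fun k x y =>
  let y' := (y - a * x) / b in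
  sum2 (fun i => pd i (shear a b k) x y' * X i x y').

Definition linearly_isomorphic (c c' : coeffs) : Prop :=
  exists a b : R, b <> 0 /\
    forall X Y, smooth_vfield half_plane X -> smooth_vfield half_plane Y ->
    forall k x y, half_plane x y ->
      nabla (typeB c') (push a b X) (push a b Y) k x y =
      push a b (nabla (typeB c) X Y) k x y.

Definition case1 (c : coeffs) : Prop :=
  c i2 i2 i1 = 0 /\ c i2 i2 i2 = c i1 i2 i1 /\ c i1 i2 i1 <> 0.

(** [s] is the common sign, 1 or -1. *)
Definition case2 (s : R) (c : coeffs) : Prop :=
  c i2 i2 i1 = s /\ c i1 i2 i1 = 0 /\
  c i2 i2 i2 = s * 2 * c i1 i1 i2 /\ s * 2 * c i1 i1 i2 <> 0 /\
  c i1 i1 i1 = 1 + 2 * c i1 i2 i2 + s * (c i1 i1 i2) ^ 2.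

(* Main.v *)
Require Import Defs.
From Stdlib Require Import Reals Lra Lia.
From Coquelicot Require Import Coquelicot.
Open Scope R_scope.

(** The whole question reduces to whether some power [(x^1)^e] solves
    [H f = - f rho_s], which is a condition on the constants [C_ij^k] alone
    ([power_exponent]).

    If [dim E(-1) = 1], the affine Killing fields [d/dx^2] and
    [x^1 d/dx^1 + x^2 d/dx^2], which preserve [E(-1)], act on it by scalars
    [a] and [b].  Their commutator is [d/dx^2], so [a = 0]: a generator does not
    depend on [x^2] and satisfies [x^1 f_1 = b f], hence it is a power of [x^1]
    ([power_exponent_of_dim]).

    The skew part of the Ricci tensor of a Type B surface is a multiple of
    [A = C_12^1 + C_22^2] ([ricci_skew]).  Suppose that [f = (x^1)^e] is in
    [E(-1)].
    - If [A = 0], the closed form [w = d log f = e dx^1 / x^1] exhibits the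
      surface as strongly projectively flat: [nabla - w (x) Id - Id (x) w] has
      symmetrized Ricci tensor [rho_s + H f / f = 0] and unchanged skew part 0,
      and in dimension two the Ricci tensor determines the curvature
      ([strongly_projectively_flat_of_power]).
    - If [A <> 0], the third derivatives of any [g] in [E(-1)] commute only if
      [A (dg - g d log f) = 0], so [g] is a multiple of [f] ([E_span_power]).

    Therefore, off the strongly projectively flat case, [dim E(-1) = 1] if and
    only if a power solution exists and [A <> 0].  Both conditions are invariant
    under linear isomorphisms, with the same exponent, since the isomorphisms
    fix [x^1] ([power_exponent_intertwines], [ricci_skew_intertwines]).  What is
    left is algebra.  If [C_22^1 = 0], the three scalar equations say exactly
    that the surface is in the first family.  If [C_22^1 <> 0], a shear brings
    [C_12^1] to 0 and a rescaling of [x^2] brings [C_22^1] to its sign, and then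
    the three equations cut out the second family ([power_normal_form]). *)

(** * Differential calculus on the half plane *)

Definition smooth (f : sfield) : Prop := smooth_on half_plane f.

Definition has_pd (i : idx) (f : sfield) (x y l : R) : Prop :=
  match i with
  | i1 => is_derive (fun t => f t y) x l
  | i2 => is_derive (fun t => f x t) y l
  end.

Lemma has_pd_pd i f x y l : has_pd i f x y l -> pd i f x y = l.
Proof. destruct i; intros H; apply is_derive_unique, H. Qed.

Lemma pd_eq i f x y l m : has_pd i f x y l -> l = m -> pd i f x y = m.
Proof. intros H <-. apply has_pd_pd, H. Qed.

Lemma half_plane_locally x y :
  half_plane x y -> locally_2d half_plane x y.
Proof.
  intros H. exists (mkposreal x H). intros u v Hu _. simpl in Hu.
  unfold half_plane in *. apply Rabs_def2 in Hu. lra.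
Qed.

Lemma half_plane_locally_eq (f g : sfield) x y :
  (forall u v, half_plane u v -> f u v = g u v) ->
  half_plane x y -> locally_2d (fun u v => f u v = g u v) x y.
Proof.
  intros H Hx. apply locally_2d_impl with (2 := half_plane_locally x y Hx).
  apply locally_2d_forall. exact H.
Qed.

Lemma pd_ext i (f g : sfield) x y :
  (forall u v, half_plane u v -> f u v = g u v) ->
  half_plane x y -> pd i f x y = pd i g x y.
Proof.
  intros H Hx. pose proof (half_plane_locally_eq f g x y H Hx) as L.
  destruct i; simpl; apply Derive_ext_loc.
  - exact (locally_2d_1d_const_y _ _ _ L).
  - exact (locally_2d_1d_const_x _ _ _ L).
Qed.

Lemma has_pd_const i (k x y : R) : has_pd i (fun _ _ => k) x y 0.
Proof. destruct i; exact (is_derive_const (K := R_AbsRing) (V := R_NormedModule) _ _). Qed.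

Lemma has_pd_fst i (x y : R) : has_pd i (fun u _ => u) x y (delta i i1).
Proof.
  destruct i; simpl.
  - exact (is_derive_id (K := R_AbsRing) _).
  - exact (is_derive_const (K := R_AbsRing) (V := R_NormedModule) _ _).
Qed.

Lemma has_pd_snd i (x y : R) : has_pd i (fun _ v => v) x y (delta i i2).
Proof.
  destruct i; simpl.
  - exact (is_derive_const (K := R_AbsRing) (V := R_NormedModule) _ _).
  - exact (is_derive_id (K := R_AbsRing) _).
Qed.

Lemma has_pd_plus i (f g : sfield) x y l m :
  has_pd i f x y l -> has_pd i g x y m ->
  has_pd i (fun u v => f u v + g u v) x y (l + m).
Proof.
  destruct i; intros H K; exact (is_derive_plus (K := R_AbsRing) (V := R_NormedModule) _ _ _ _ _ H K).
Qed.

Lemma has_pd_minus i (f g : sfield) x y l m :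
  has_pd i f x y l -> has_pd i g x y m ->
  has_pd i (fun u v => f u v - g u v) x y (l - m).
Proof.
  destruct i; intros H K; exact (is_derive_minus (K := R_AbsRing) (V := R_NormedModule) _ _ _ _ _ H K).
Qed.

Lemma has_pd_mult i (f g : sfield) x y l m :
  has_pd i f x y l -> has_pd i g x y m ->
  has_pd i (fun u v => f u v * g u v) x y (l * g x y + f x y * m).
Proof.
  destruct i; intros H K;
    exact (is_derive_mult (K := R_AbsRing) _ _ _ _ _ H K Rmult_comm).
Qed.

Lemma has_pd_inv_fst i (x y : R) :
  half_plane x y -> has_pd i (fun u _ => / u) x y (- delta i i1 * / x * / x).
Proof.
  unfold half_plane. intros Hx. destruct i; simpl.
  - replace (- (1) * / x * / x) with (- 1 / x ^ 2) by (field; lra).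
    apply is_derive_inv; [|lra]. exact (is_derive_id (K := R_AbsRing) _).
  - replace (- 0 * / x * / x) with 0 by ring.
    exact (is_derive_const (K := R_AbsRing) (V := R_NormedModule) _ _).
Qed.

Lemma smooth_has_pd i f x y :
  smooth f -> half_plane x y -> has_pd i f x y (pd i f x y).
Proof.
  intros H Hx. destruct (H 1%nat x y Hx) as (_ & H1 & H2 & _).
  destruct i; apply Derive_correct; assumption.
Qed.

Lemma smooth_pd i f : smooth f -> smooth (pd i f).
Proof.
  intros H n x y Hx. destruct (H (S n) x y Hx) as (_ & _ & _ & H1 & H2).
  destruct i; assumption.
Qed.

Lemma smooth_ext (f g : sfield) :
  (forall u v, half_plane u v -> f u v = g u v) -> smooth f -> smooth g.
Proof.
  intros H Hf n x y Hx.
  apply ex_diff_n_ext_loc with (2 := Hf n x y Hx).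
  apply half_plane_locally_eq; assumption.
Qed.

Lemma smooth_continuous f x y :
  smooth f -> half_plane x y -> continuity_2d_pt f x y.
Proof. intros H Hx. exact (proj1 (H 0%nat x y Hx)). Qed.

(** Class [C^n] on the half plane; [smooth f] is [diff_n n f] for every [n]. *)
Definition diff_n (n : nat) (f : sfield) : Prop :=
  forall x y, half_plane x y -> ex_diff_n f n x y.

(** Closure properties of smooth functions are proved one order at a time: the
    product rule expresses the derivatives of a product through products of
    functions with one derivative less. *)
Lemma diff_n_S n (f : sfield) (f' : idx -> sfield) :
  (forall x y, half_plane x y -> continuity_2d_pt f x y) ->
  (forall i x y, half_plane x y -> has_pd i f x y (f' i x y)) ->
  (forall i, diff_n n (f' i)) -> diff_n (S n) f.
Proof.
  intros Hc Hd Hn x y Hx. split; [apply Hc, Hx|].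
  assert (K : forall i, ex_diff_n (pd i f) n x y).
  { intros i. apply ex_diff_n_ext_loc with (2 := Hn i x y Hx).
    apply half_plane_locally_eq; [|exact Hx].
    intros u v Hu. symmetry. apply has_pd_pd, Hd, Hu. }
  repeat split.
  - exists (f' i1 x y). exact (Hd i1 x y Hx).
  - exists (f' i2 x y). exact (Hd i2 x y Hx).
  - exact (K i1).
  - exact (K i2).
Qed.

Lemma diff_n_le n m f : (m <= n)%nat -> diff_n n f -> diff_n m f.
Proof. intros L H x y Hx. apply ex_diff_n_m with n; auto. Qed.

Lemma diff_n_continuous n f x y :
  diff_n n f -> half_plane x y -> continuity_2d_pt f x y.
Proof. intros H Hx. specialize (H x y Hx). destruct n; apply H. Qed.

Lemma diff_n_has_pd n i f x y :
  diff_n (S n) f -> half_plane x y -> has_pd i f x y (pd i f x y).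
Proof.
  intros H Hx. destruct (H x y Hx) as (_ & H1 & H2 & _).
  destruct i; apply Derive_correct; assumption.
Qed.

Lemma diff_n_pd n i f : diff_n (S n) f -> diff_n n (pd i f).
Proof.
  intros H x y Hx. destruct (H x y Hx) as (_ & _ & _ & H1 & H2).
  destruct i; assumption.
Qed.

Lemma diff_n_plus n : forall f g,
  diff_n n f -> diff_n n g -> diff_n n (fun x y => f x y + g x y).
Proof.
  induction n as [|n IH]; intros f g Hf Hg.
  - intros x y Hx; split; [|exact I].
    apply continuity_2d_pt_plus; [apply (Hf x y Hx)|apply (Hg x y Hx)].
  - apply diff_n_S with (f' := fun i x y => pd i f x y + pd i g x y).
    + intros x y Hx.
      apply continuity_2d_pt_plus; eapply diff_n_continuous; eauto.
    + intros i x y Hx. apply has_pd_plus; eapply diff_n_has_pd; eauto.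
    + intros i. apply IH; apply diff_n_pd; assumption.
Qed.

Lemma diff_n_mult n : forall f g,
  diff_n n f -> diff_n n g -> diff_n n (fun x y => f x y * g x y).
Proof.
  induction n as [|n IH]; intros f g Hf Hg.
  - intros x y Hx; split; [|exact I].
    apply continuity_2d_pt_mult; [apply (Hf x y Hx)|apply (Hg x y Hx)].
  - apply diff_n_S with (f' := fun i x y => pd i f x y * g x y + f x y * pd i g x y).
    + intros x y Hx.
      apply continuity_2d_pt_mult; eapply diff_n_continuous; eauto.
    + intros i x y Hx. apply has_pd_mult; eapply diff_n_has_pd; eauto.
    + intros i. apply diff_n_plus; apply IH;
        solve [apply diff_n_pd; assumption
              | apply diff_n_le with (S n); auto with arith].
Qed.

Lemma smooth_plus f g :
  smooth f -> smooth g -> smooth (fun x y => f x y + g x y).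
Proof. intros Hf Hg n. exact (diff_n_plus n f g (Hf n) (Hg n)). Qed.

Lemma smooth_mult f g :
  smooth f -> smooth g -> smooth (fun x y => f x y * g x y).
Proof. intros Hf Hg n. exact (diff_n_mult n f g (Hf n) (Hg n)). Qed.

Lemma smooth_const k : smooth (fun _ _ => k).
Proof.
  assert (H : forall n c, diff_n n (fun _ _ => c)).
  { induction n as [|n IH]; intros c.
    - intros x y _; split; [apply continuity_2d_pt_const|exact I].
    - apply diff_n_S with (f' := fun _ _ _ => 0).
      + intros; apply continuity_2d_pt_const.
      + intros; apply has_pd_const.
      + intros; apply IH. }
  intros n. apply H.
Qed.

Lemma smooth_fst : smooth (fun x _ => x).
Proof.
  intros [|n].
  - intros x y _; split; [apply continuity_2d_pt_id1|exact I].
  - apply diff_n_S with (f' := fun i _ _ => delta i i1).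
    + intros; apply continuity_2d_pt_id1.
    + intros; apply has_pd_fst.
    + intros i. exact (smooth_const _ n).
Qed.

Lemma smooth_snd : smooth (fun _ y => y).
Proof.
  intros [|n].
  - intros x y _; split; [apply continuity_2d_pt_id2|exact I].
  - apply diff_n_S with (f' := fun i _ _ => delta i i2).
    + intros; apply continuity_2d_pt_id2.
    + intros; apply has_pd_snd.
    + intros i. exact (smooth_const _ n).
Qed.

Lemma has_pd_power i k b x y :
  half_plane x y ->
  has_pd i (fun u _ => k * Rpower u b) x y
    (delta i i1 * k * b * Rpower x (b - 1)).
Proof.
  intros Hx. destruct i; simpl.
  - replace (1 * k * b * Rpower x (b - 1)) with (k * (b * Rpower x (b - 1))) by ring.
    apply (is_derive_scal (fun u => Rpower u b)).
    apply is_derive_Reals, derivable_pt_lim_power, Hx.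
  - rewrite !Rmult_0_l. exact (is_derive_const (K := R_AbsRing) (V := R_NormedModule) _ _).
Qed.

(** The induction on the order runs over all factors and exponents at once,
    because differentiating [k x^b] gives [k b x^(b - 1)]. *)
Lemma smooth_power k b : smooth (fun x _ => k * Rpower x b).
Proof.
  assert (C : forall k b x y, half_plane x y ->
    continuity_2d_pt (fun x _ => k * Rpower x b) x y).
  { intros k' b' x y Hx.
    apply (continuity_1d_2d_pt_comp (fun u => k' * Rpower u b') (fun u _ => u)).
    - apply derivable_continuous_pt.
      exists (delta i1 i1 * k' * b' * Rpower x (b' - 1)).
      apply is_derive_Reals. exact (has_pd_power i1 k' b' x y Hx).
    - apply continuity_2d_pt_id1. }
  assert (H : forall n k b, diff_n n (fun x _ => k * Rpower x b)).
  { induction n as [|n IH]; intros k' b'.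
    - intros x y Hx; split; [apply C, Hx|exact I].
    - apply diff_n_S with
        (f' := fun i x _ => delta i i1 * k' * b' * Rpower x (b' - 1)).
      + intros; apply C; assumption.
      + intros; apply has_pd_power; assumption.
      + intros; apply IH. }
  intros n. apply H.
Qed.

Lemma smooth_inv_fst k : smooth (fun x _ => / x * k).
Proof.
  apply smooth_ext with (2 := smooth_power k (-(1))).
  intros u v Hu. rewrite Rpower_Ropp, Rpower_1 by exact Hu. ring.
Qed.

Lemma pd_comm f x y :
  smooth f -> half_plane x y -> pd i1 (pd i2 f) x y = pd i2 (pd i1 f) x y.
Proof.
  intros Hf Hx. simpl. apply Schwarz.
  - apply locally_2d_impl with (2 := half_plane_locally x y Hx).
    apply locally_2d_forall. intros u v Hu.
    repeat split; eexists.
    + exact (smooth_has_pd i1 f u v Hf Hu).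
    + exact (smooth_has_pd i2 f u v Hf Hu).
    + exact (smooth_has_pd i1 _ u v (smooth_pd i2 f Hf) Hu).
    + exact (smooth_has_pd i2 _ u v (smooth_pd i1 f Hf) Hu).
  - exact (smooth_continuous _ x y (smooth_pd i1 _ (smooth_pd i2 f Hf)) Hx).
  - exact (smooth_continuous _ x y (smooth_pd i2 _ (smooth_pd i1 f Hf)) Hx).
Qed.

(** Needed for the chain rule along the shears, where existence of partial
    derivatives would not suffice. *)
Lemma smooth_differentiable f x y :
  smooth f -> half_plane x y ->
  differentiable_pt_lim f x y (pd i1 f x y) (pd i2 f x y).
Proof.
  intros Hf Hx. apply filterdiff_differentiable_pt_lim.
  apply filterdiff_ext_lin with
    (fun u : R * R => plus (scal (fst u) (pd i1 f x y)) (scal (snd u) (pd i2 f x y)));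
    [|intros u; reflexivity].
  apply is_derive_filterdiff.
  - apply (locally_2d_locally (fun u v => is_derive (fun z => f z v) u (pd i1 f u v))).
    apply locally_2d_impl with (2 := half_plane_locally x y Hx).
    apply locally_2d_forall. intros u v Hu.
    exact (smooth_has_pd i1 f u v Hf Hu).
  - exact (smooth_has_pd i2 f x y Hf Hx).
  - apply continuity_2d_pt_filterlim.
    exact (smooth_continuous _ x y (smooth_pd i1 f Hf) Hx).
Qed.

Create HintDb smooth.
#[export] Hint Resolve smooth_pd smooth_plus smooth_mult smooth_const smooth_fst
  smooth_snd smooth_inv_fst smooth_power : smooth.

(** Reduces a partial derivative along the shape of the function.  The value
    in the goal has to be an evar, which becomes the computed derivative; the
    opaque factors are left to the hypotheses that they are smooth. *)
Ltac derive_pd :=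
  lazymatch goal with
  | |- has_pd _ (fun u v => _ + _) _ _ _ => apply has_pd_plus; derive_pd
  | |- has_pd _ (fun u v => _ - _) _ _ _ => apply has_pd_minus; derive_pd
  | |- has_pd _ (fun u v => _ * _) _ _ _ => apply has_pd_mult; derive_pd
  | |- has_pd _ (fun u v => / u) _ _ _ => apply has_pd_inv_fst; assumption
  | |- has_pd _ (fun u _ => u) _ _ _ => apply has_pd_fst
  | |- has_pd _ (fun _ v => v) _ _ _ => apply has_pd_snd
  | |- has_pd _ (fun _ _ => _) _ _ _ =>
      first [apply has_pd_const | apply smooth_has_pd; auto with smooth]
  | |- _ => apply smooth_has_pd; auto with smooth
  end.

(** * Curvature and the equation on Type B surfaces *)

(** [(x^1)^-2 curv_coeff c l k] is the component along [d_k] of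
    [R(d_1, d_2) d_l]; the first term comes from [d_1 (1 / x^1)]. *)
Definition curv_coeff (c : coeffs) (l k : idx) : R :=
  - c i2 l k + sum2 (fun m => c i2 l m * c i1 m k - c i1 l m * c i2 m k).

Lemma pd_nabla c Y Z i k x y :
  smooth_vfield half_plane Y -> smooth_vfield half_plane Z -> half_plane x y ->
  pd i (nabla (typeB c) Y Z k) x y =
  sum2 (fun j =>
    pd i (Y j) x y * (pd j (Z k) x y + sum2 (fun l => / x * c j l k * Z l x y))
    + Y j x y * (pd i (pd j (Z k)) x y + sum2 (fun l =>
        - delta i i1 * / x * / x * c j l k * Z l x y
        + / x * c j l k * pd i (Z l) x y))).
Proof.
  intros HY HZ Hx.
  assert (SY : forall j, smooth (Y j)) by exact HY.
  assert (SZ : forall j, smooth (Z j)) by exact HZ.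
  unfold nabla, typeB, sum2.
  eapply pd_eq; [derive_pd|cbv beta; ring].
Qed.

(** Tensoriality of the curvature: the derivatives of [X], [Y] and [Z] cancel,
    those of second order by the symmetry of second partial derivatives of
    [Z]. *)
Lemma curv_typeB c X Y Z k x y :
  smooth_vfield half_plane X -> smooth_vfield half_plane Y ->
  smooth_vfield half_plane Z -> half_plane x y ->
  curv (typeB c) X Y Z k x y =
  (X i1 x y * Y i2 x y - X i2 x y * Y i1 x y) * / x * / x *
  sum2 (fun l => Z l x y * curv_coeff c l k).
Proof.
  intros HX HY HZ Hx.
  assert (E1 : forall V W, nabla (typeB c) V W k x y = sum2 (fun i => V i x y *
    (pd i (W k) x y + sum2 (fun j => / x * c i j k * W j x y)))) by reflexivity.
  unfold curv.
  rewrite !E1; unfold sum2 at 1 3 5.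
  rewrite !pd_nabla by assumption.
  unfold nabla, typeB, bracket, curv_coeff, sum2.
  pose proof (pd_comm (Z k) x y (HZ k) Hx) as Hc. rewrite Hc.
  simpl delta. ring.
Qed.

(** In dimension two the trace defining [rho(d_j, d_k)] has a single nonzero
    term, so that the Ricci tensor and the curvature have the same
    components up to sign. *)
Definition ric (c : coeffs) (j k : idx) : R :=
  match j with i1 => - curv_coeff c k i2 | i2 => curv_coeff c k i1 end.

Definition ric_s (c : coeffs) (j k : idx) : R := (ric c j k + ric c k j) / 2.

Lemma smooth_coord i : smooth_vfield half_plane (coord i).
Proof. intros j. exact (smooth_const (delta i j)). Qed.

Lemma ricci_typeB c j k x y :
  half_plane x y -> ricci (typeB c) j k x y = ric c j k * / x * / x.
Proof.
  intros Hx. unfold ricci, sum2 at 1.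
  rewrite !curv_typeB by auto using smooth_coord.
  unfold coord, sum2 at 1 2, ric. destruct j, k; simpl delta; ring.
Qed.

Lemma ricci_s_typeB c j k x y :
  half_plane x y -> ricci_s (typeB c) j k x y = ric_s c j k * / x * / x.
Proof.
  intros Hx. unfold ricci_s, ric_s. rewrite !ricci_typeB by exact Hx. field.
  unfold half_plane in Hx. lra.
Qed.

(** The second derivative [d_i d_j f] prescribed by [H f = - f rho_s]. *)
Definition hess_rhs c i j f : sfield := fun x y =>
  / x * (c i j i1 * pd i1 f x y + c i j i2 * pd i2 f x y)
  - ric_s c i j * (/ x * / x) * f x y.

Lemma E_typeB c f :
  E (-1) (typeB c) f <->
  smooth f /\ forall i j x y, half_plane x y ->
    pd i (pd j f) x y = hess_rhs c i j f x y.
Proof.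
  unfold E. split; intros [Hs H]; (split; [exact Hs|]); intros i j x y Hx;
    specialize (H i j x y Hx); revert H;
    rewrite ricci_s_typeB by exact Hx;
    unfold hessian, hess_rhs, typeB, sum2; lra.
Qed.

Lemma pd_hess_rhs c i j k f x y :
  smooth f -> half_plane x y ->
  pd k (hess_rhs c i j f) x y =
  - delta k i1 * / x * / x * (c i j i1 * pd i1 f x y + c i j i2 * pd i2 f x y)
  + / x * (c i j i1 * pd k (pd i1 f) x y + c i j i2 * pd k (pd i2 f) x y)
  - ric_s c i j * (- 2 * delta k i1 * / x * / x * / x * f x y
                   + / x * / x * pd k f x y).
Proof.
  intros Hs Hx. unfold hess_rhs.
  eapply pd_eq; [derive_pd|cbv beta; ring].
Qed.

(** On [E(-1)] the third derivatives are functions of [f] and its gradient: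
    differentiate the equation once and substitute it into the result. *)
Lemma E_third_derivative c f i j k x y :
  E (-1) (typeB c) f -> half_plane x y ->
  pd k (pd i (pd j f)) x y =
  - delta k i1 * / x * / x * (c i j i1 * pd i1 f x y + c i j i2 * pd i2 f x y)
  + / x * (c i j i1 * hess_rhs c k i1 f x y + c i j i2 * hess_rhs c k i2 f x y)
  - ric_s c i j * (- 2 * delta k i1 * / x * / x * / x * f x y
                   + / x * / x * pd k f x y).
Proof.
  intros HE Hx. apply E_typeB in HE. destruct HE as [Hs H].
  rewrite (pd_ext k _ (hess_rhs c i j f)) by (try exact Hx; apply H).
  rewrite pd_hess_rhs by assumption. rewrite !H by exact Hx. reflexivity.
Qed.

(** * Power solutions *)

(** The equation [H f = - f rho_s] for [f = (x^1)^b], divided by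
    [(x^1)^(b - 2)]. *)
Definition power_exponent (c : coeffs) (b : R) : Prop :=
  forall i j, delta i i1 * delta j i1 * (b * (b - 1)) =
    c i j i1 * b - ric_s c i j.

(** Equals [(x^1)^2 (rho_12 - rho_21)]. *)
Definition ricci_skew (c : coeffs) : R := c i1 i2 i1 + c i2 i2 i2.

Lemma power_in_E c b k :
  power_exponent c b -> E (-1) (typeB c) (fun x _ => k * Rpower x b).
Proof.
  intros H. apply E_typeB. split; [apply smooth_power|].
  intros i j x y Hx. unfold hess_rhs.
  assert (P : forall i m, pd i (fun x _ => m * Rpower x b) x y =
     delta i i1 * m * b * Rpower x (b - 1)).
  { intros. apply has_pd_pd, has_pd_power, Hx. }
  rewrite !P.
  rewrite (pd_ext i _ (fun u _ => (delta j i1 * k * b) * Rpower u (b - 1)) x y);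
    [|intros; apply has_pd_pd, has_pd_power; assumption|exact Hx].
  rewrite (has_pd_pd _ _ _ _ _ (has_pd_power i (delta j i1 * k * b) (b-1) x y Hx)).
  assert (Q : forall d, Rpower x (d - 1) = Rpower x d * / x).
  { intros d. unfold Rminus. rewrite Rpower_plus, Rpower_Ropp, Rpower_1 by exact Hx.
    reflexivity. }
  rewrite !Q. simpl delta.
  transitivity ((delta i i1 * delta j i1 * (b * (b - 1))) * (k * Rpower x b * / x * / x));
    [ring|]. rewrite (H i j). ring.
Qed.

(** The two conditions [d_1 d_2 d_j f = d_2 d_1 d_j f] are linear in
    [(f, f_1, f_2)].  Since [(x^1)^b] satisfies them, they are linear in the
    difference [df - b f dx^1 / x^1].  The part of the curvature that comes from
    [rho_s] cancels against the right-hand side of the equation, and the skew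
    part acts, up to sign and a power of [x^1], as the scalar
    [ricci_skew c / 2]. *)
Lemma E_gradient c b f x y :
  sym_coeffs c -> power_exponent c b -> ricci_skew c <> 0 ->
  E (-1) (typeB c) f -> half_plane x y ->
  x * pd i1 f x y = b * f x y /\ pd i2 f x y = 0.
Proof.
  intros Hc Hb Ha HE Hx.
  assert (Hs : smooth f) by apply HE.
  assert (x0 : x <> 0) by (unfold half_plane in Hx; lra).
  assert (C1 := pd_comm (pd i1 f) x y (smooth_pd _ _ Hs) Hx).
  assert (C2 := pd_comm (pd i2 f) x y (smooth_pd _ _ Hs) Hx).
  rewrite !(E_third_derivative c) in C1, C2 by assumption.
  unfold hess_rhs in C1, C2. simpl delta in C1, C2.
  assert (R11 : ric_s c i1 i1 = c i1 i1 i1 * b - b * (b - 1)).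
  { generalize (Hb i1 i1). simpl. lra. }
  assert (R12 : ric_s c i1 i2 = c i1 i2 i1 * b).
  { generalize (Hb i1 i2). simpl. lra. }
  assert (R21 : ric_s c i2 i1 = c i1 i2 i1 * b).
  { generalize (Hb i2 i1). simpl. rewrite (Hc i2 i1). lra. }
  assert (R22 : ric_s c i2 i2 = c i2 i2 i1 * b).
  { generalize (Hb i2 i2). simpl. lra. }
  pose proof R11 as D11. pose proof R12 as D12. pose proof R22 as D22.
  unfold ric_s, ric, curv_coeff, sum2 in D11, D12, D22.
  rewrite R11, R12, R21, R22 in C1, C2.
  rewrite !(Hc i2 i1) in *.
  (* The components of x (df - b f dx / x), which have to vanish. *)
  set (h1 := x * pd i1 f x y - b * f x y).
  set (h2 := x * pd i2 f x y).
  replace (pd i1 f x y) with ((h1 + b * f x y) * / x) in C1, C2 by (unfold h1; field; exact x0).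
  replace (pd i2 f x y) with (h2 * / x) in C1, C2 by (unfold h2; field; exact x0).
  apply Rminus_diag_eq in C1, C2, D11, D12, D22.
  (* [e1], [e2] are the integrability conditions and [d11], [d12], [d22] the
     equations for the exponent, all of them equal to 0. *)
  match type of C1 with ?e1 = 0 => match type of C2 with ?e2 = 0 =>
  match type of D11 with ?d11 = 0 => match type of D12 with ?d12 = 0 =>
  match type of D22 with ?d22 = 0 =>
    assert (A1 : ricci_skew c * h1 =
      - 2 * (x * x * x * e1) + 2 * d12 * h1 - 2 * d11 * h2)
      by (unfold ricci_skew; field; exact x0);
    assert (A2 : ricci_skew c * h2 =
      - 2 * (x * x * x * e2) + 2 * d22 * h1 - 2 * d12 * h2)
      by (unfold ricci_skew; field; exact x0)
  end end end end end.
  rewrite C1, D11, D12 in A1. rewrite C2, D12, D22 in A2.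
  assert (B1 : h1 = 0) by (apply (Rmult_eq_reg_l (ricci_skew c)); lra).
  assert (B2 : h2 = 0) by (apply (Rmult_eq_reg_l (ricci_skew c)); lra).
  split.
  - unfold h1 in B1; lra.
  - unfold h2 in B2. apply Rmult_integral in B2. tauto.
Qed.

Lemma E_ext mu G (f g : sfield) :
  (forall x y, half_plane x y -> f x y = g x y) -> E mu G f -> E mu G g.
Proof.
  intros H [Hs HE]. split; [exact (smooth_ext f g H Hs)|].
  intros i j x y Hx. rewrite <- H by exact Hx. rewrite <- HE by exact Hx.
  assert (P : forall k u v, half_plane u v -> pd k g u v = pd k f u v).
  { intros. symmetry. apply pd_ext; assumption. }
  unfold hessian, sum2. rewrite !P by exact Hx.
  rewrite (pd_ext i (pd j g) (pd j f)); auto.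
Qed.

Lemma constant_of_derive_zero (h : R -> R) u v :
  (forall t, Rmin u v <= t -> is_derive h t 0) -> h u = h v.
Proof.
  intros H. destruct (Rtotal_order u v) as [L|[L|L]].
  - apply (eq_is_derive (V := R_NormedModule)); [|exact L].
    intros t [Ht _]. apply H. rewrite Rmin_left; lra.
  - now rewrite L.
  - symmetry. apply (eq_is_derive (V := R_NormedModule)); [|exact L].
    intros t [Ht _]. apply H. rewrite Rmin_right; lra.
Qed.

(** With [E_gradient], [g] does not depend on [x^2] and [g (x^1)^-b] does not
    depend on [x^1]. *)
Lemma E_span_power c b :
  sym_coeffs c -> power_exponent c b -> ricci_skew c <> 0 ->
  E_is_span (-1) (typeB c) (fun x _ => Rpower x b).
Proof.
  intros Hc Hb Ha g. split.
  - intros HE. exists (g 1 0). intros x y Hx.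
    assert (Hs : smooth g) by apply HE.
    assert (V : g x y = g x 0).
    { apply (constant_of_derive_zero (g x)). intros t _.
      destruct (E_gradient c b g x t Hc Hb Ha HE Hx) as [_ H2]. rewrite <- H2.
      exact (smooth_has_pd i2 g x t Hs Hx). }
    assert (W : g x 0 * (1 * Rpower x (- b)) = g 1 0 * (1 * Rpower 1 (- b))).
    { apply (constant_of_derive_zero (fun t => g t 0 * (1 * Rpower t (- b)))).
      intros t Ht.
      assert (Ht0 : half_plane t 0).
      { unfold half_plane in *. apply Rlt_le_trans with (2 := Ht).
        apply Rmin_glb_lt; lra. }
      destruct (E_gradient c b g t 0 Hc Hb Ha HE Ht0) as [H1 _].
      assert (D := has_pd_mult i1 g (fun u _ => 1 * Rpower u (- b)) t 0 _ _
        (smooth_has_pd i1 g t 0 Hs Ht0) (has_pd_power i1 1 (- b) t 0 Ht0)).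
      replace (pd i1 g t 0) with (b * g t 0 * / t) in D
        by (rewrite <- H1; unfold half_plane in Ht0; field; lra).
      unfold Rminus in D.
      rewrite Rpower_plus, (Rpower_Ropp t 1), Rpower_1 in D by exact Ht0.
      match type of D with has_pd _ _ _ _ ?l =>
        replace l with 0 in D by (simpl delta; ring) end.
      exact D. }
    rewrite V. rewrite !Rpower_Ropp in W.
    assert (P : 0 < Rpower x b) by apply exp_pos.
    assert (P1 : Rpower 1 b = 1) by (unfold Rpower; rewrite ln_1, Rmult_0_r; apply exp_0).
    rewrite P1, Rinv_1 in W.
    apply (Rmult_eq_reg_r (1 * / Rpower x b)).
    + rewrite W. field. lra.
    + rewrite Rmult_1_l. apply Rinv_neq_0_compat. lra.
  - intros [k Hk]. apply E_ext with (fun x _ => k * Rpower x b).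
    + intros x y Hx. symmetry. apply Hk, Hx.
    + apply power_in_E, Hb.
Qed.

Lemma dim_E_of_span mu c b :
  E_is_span mu (typeB c) (fun x _ => Rpower x b) -> dim_E mu (typeB c) 1.
Proof.
  intros H. exists (fun _ p => Rpower (fst p) b). split; [|split].
  - intros i _. apply H. exists 1. intros. simpl. ring.
  - intros a Ha i Hi. replace i with 0%nat by lia.
    assert (K := Ha (1, 0) Rlt_0_1). simpl in K.
    assert (P : 0 < Rpower 1 b) by apply exp_pos.
    apply (Rmult_eq_reg_r (Rpower 1 b)); lra.
  - intros f Hf. apply H in Hf. destruct Hf as [a Ha].
    exists (fun _ => a). intros [x y] Hx. simpl. rewrite (Ha x y Hx). ring.
Qed.

(** The coefficients of [nabla - w (x) Id - Id (x) w] for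
    [w = k dx^1 / x^1]. *)
Definition remove_form (k : R) (c : coeffs) : coeffs := fun i j l =>
  c i j l - k * (delta i i1 * delta j l + delta j i1 * delta i l).

Lemma flat_typeB c :
  (forall l k, curv_coeff c l k = 0) -> flat half_plane (typeB c).
Proof.
  intros H X Y Z HX HY HZ k x y Hx. rewrite curv_typeB by assumption.
  unfold sum2. rewrite !H. ring.
Qed.

(** Each curvature component of the modified connection is, up to sign, one of
    the equations for the exponent [b], corrected by a multiple of
    [ricci_skew c]. *)
Lemma remove_form_flat c b :
  sym_coeffs c -> power_exponent c b -> ricci_skew c = 0 ->
  forall l k, curv_coeff (remove_form b c) l k = 0.
Proof.
  intros Hc Hb Ha.
  assert (R11 := Hb i1 i1). assert (R12 := Hb i1 i2). assert (R22 := Hb i2 i2).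
  unfold ric_s, ric, curv_coeff, sum2 in R11, R12, R22.
  unfold ricci_skew in Ha.
  intros l k. unfold curv_coeff, remove_form, sum2.
  destruct l, k; simpl delta in *; rewrite ?(Hc i2 i1) in *; lra.
Qed.

Lemma strongly_projectively_flat_of_power c b :
  sym_coeffs c -> power_exponent c b -> ricci_skew c = 0 ->
  strongly_projectively_flat (typeB c).
Proof.
  intros Hc Hb Ha x0 y0 Hx0.
  exists half_plane, (typeB (remove_form b c)), (fun i x _ => / x * (b * delta i i1)).
  repeat apply conj.
  - exact Hx0.
  - exact half_plane_locally.
  - auto.
  - intros i j k. apply smooth_inv_fst.
  - intros i j k x y _. unfold typeB, remove_form. rewrite (Hc j i). ring.
  - apply flat_typeB, remove_form_flat; assumption.
  - intros i. apply smooth_inv_fst.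
  - intros i j x y Hx.
    assert (P : forall k l, pd k (fun x _ => / x * (b * delta l i1)) x y
      = - / x * / x * b * (delta k i1 * delta l i1)).
    { intros k l. eapply pd_eq; [derive_pd|cbv beta; ring]. }
    rewrite !P. ring.
  - intros X Y _ _ k x y _.
    unfold nabla, apply_form, typeB, remove_form, sum2.
    destruct k; simpl delta; ring.
Qed.

(** * Symmetries of the solution space *)

Lemma pd_swap i j f x y :
  smooth f -> half_plane x y -> pd i (pd j f) x y = pd j (pd i f) x y.
Proof.
  intros Hs Hx. destruct i, j; try reflexivity.
  - apply pd_comm; assumption.
  - symmetry. apply pd_comm; assumption.
Qed.

Lemma pd_rotate i j k f x y :
  smooth f -> half_plane x y ->
  pd i (pd j (pd k f)) x y = pd k (pd i (pd j f)) x y.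
Proof.
  intros Hs Hx.
  rewrite (pd_ext i _ (pd k (pd j f))) by (try exact Hx; intros; apply pd_swap; assumption).
  apply pd_swap; [apply smooth_pd|]; assumption.
Qed.

(** The coefficients of the equation do not depend on [x^2]. *)
Lemma E_translation c f :
  E (-1) (typeB c) f -> E (-1) (typeB c) (pd i2 f).
Proof.
  intros HE. assert (Hs : smooth f) by apply HE.
  assert (H := proj2 (proj1 (E_typeB c f) HE)).
  apply E_typeB. split; [apply smooth_pd, Hs|].
  intros i j x y Hx. rewrite pd_rotate by assumption.
  rewrite (E_third_derivative c) by assumption. unfold hess_rhs at 3.
  rewrite (pd_swap i1 i2 f) by assumption. rewrite !H by exact Hx.
  simpl delta. ring.
Qed.

Definition euler (f : sfield) : sfield := fun x y =>
  x * pd i1 f x y + y * pd i2 f x y.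

(** Both [H] and [rho_s] are invariant under the dilations of the half plane:
    the coefficients of the equation are homogeneous of degrees -1 and -2, and
    [d_i d_j (euler f) = euler (d_i d_j f) + 2 d_i d_j f]. *)
Lemma E_euler c f : E (-1) (typeB c) f -> E (-1) (typeB c) (euler f).
Proof.
  intros HE. assert (Hs : smooth f) by apply HE.
  assert (H := proj2 (proj1 (E_typeB c f) HE)).
  assert (P : forall j x y, half_plane x y -> pd j (euler f) x y =
    pd j f x y + x * pd j (pd i1 f) x y + y * pd j (pd i2 f) x y).
  { intros j x y Hx. unfold euler. eapply pd_eq; [derive_pd|].
    cbv beta. destruct j; simpl delta; ring. }
  apply E_typeB. split; [unfold euler; auto 10 with smooth|].
  intros i j x y Hx. unfold hess_rhs at 1.
  rewrite !P by exact Hx. rewrite (pd_ext i _ _ x y (P j) Hx).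
  transitivity (pd i (pd j f) x y + (delta i i1 * pd j (pd i1 f) x y
     + delta i i2 * pd j (pd i2 f) x y)
     + x * pd i (pd j (pd i1 f)) x y + y * pd i (pd j (pd i2 f)) x y).
  { eapply pd_eq; [derive_pd|]. cbv beta. ring. }
  rewrite (pd_rotate i j i1), (pd_rotate i j i2) by assumption.
  rewrite !(E_third_derivative c) by assumption.
  assert (S : hess_rhs c i2 i1 f x y = hess_rhs c i1 i2 f x y).
  { rewrite <- !H by exact Hx. symmetry. apply pd_comm; assumption. }
  assert (S' : delta i i1 * pd j (pd i1 f) x y + delta i i2 * pd j (pd i2 f) x y
    = hess_rhs c i j f x y).
  { rewrite <- H, (pd_swap i j f) by assumption. destruct i; simpl delta; ring. }
  rewrite S'. rewrite !H by exact Hx. rewrite S.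
  unfold hess_rhs at 1 2. unfold euler.
  simpl delta. field. unfold half_plane in Hx; lra.
Qed.

(** A generator [f] is a common eigenvector of two symmetries with
    [[d_2, euler] = d_2], so its eigenvalue under [d_2] is zero.  The
    eigenvalue under [euler] is the exponent. *)
Lemma power_exponent_of_dim c :
  dim_E (-1) (typeB c) 1 -> exists b, power_exponent c b.
Proof.
  intros (F & HV & Hind & Hspan).
  set (f := fun x y => F 0%nat (x, y)).
  assert (HE : E (-1) (typeB c) f) by (apply HV; lia).
  assert (Hs : smooth f) by apply HE.
  assert (H := proj2 (proj1 (E_typeB c f) HE)).
  assert (Z : forall a, (forall x y, half_plane x y -> a * f x y = 0) -> a = 0).
  { intros a Ha. apply (Hind (fun _ => a)) with (i := 0%nat); [|lia].
    intros [x y] Hx. simpl. rewrite Rplus_0_l. apply (Ha x y Hx). }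
  assert (M : forall g, E (-1) (typeB c) g ->
    exists a, forall x y, half_plane x y -> g x y = a * f x y).
  { intros g Hg. destruct (Hspan (fun p => g (fst p) (snd p)) Hg) as [a Ha].
    exists (a 0%nat). intros x y Hx.
    assert (K := Ha (x, y) Hx). simpl in K. rewrite K. unfold f. ring. }
  destruct (M _ (E_translation c f HE)) as [a Ha].
  destruct (M _ (E_euler c f HE)) as [b Hb].
  (* Differentiating [euler f = b f] in x^2 gives a b f + a f = b a f. *)
  assert (a0 : a = 0).
  { apply Z. intros x y Hx.
    assert (D : pd i2 (euler f) x y = b * pd i2 f x y).
    { rewrite (pd_ext i2 _ _ x y Hb Hx).
      eapply pd_eq; [derive_pd|cbv beta; ring]. }
    assert (D' : pd i2 (euler f) x y =
      x * pd i2 (pd i1 f) x y + pd i2 f x y + y * pd i2 (pd i2 f) x y).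
    { unfold euler. eapply pd_eq; [derive_pd|cbv beta; simpl delta; ring]. }
    assert (D2 : forall i, pd i (pd i2 f) x y = a * pd i f x y).
    { intros i. rewrite (pd_ext i _ _ x y Ha Hx).
      eapply pd_eq; [derive_pd|cbv beta; ring]. }
    rewrite <- (pd_comm f) in D' by assumption. rewrite !D2 in D'.
    rewrite D' in D. assert (B := Hb x y Hx). unfold euler in B.
    rewrite Ha in * by exact Hx.
    apply (f_equal (Rmult a)) in B. lra. }
  exists b.
  assert (F2 : forall x y, half_plane x y -> pd i2 f x y = 0).
  { intros x y Hx. rewrite Ha by exact Hx. rewrite a0. ring. }
  assert (F1 : forall j x y, half_plane x y ->
    pd j f x y = / x * (b * delta j i1) * f x y).
  { intros j x y Hx. destruct j; simpl delta.
    - assert (B := Hb x y Hx). unfold euler in B. rewrite F2 in B by exact Hx.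
      unfold half_plane in Hx.
      replace (/ x * (b * 1) * f x y) with (/ x * (b * f x y)) by ring.
      rewrite <- B. field. lra.
    - rewrite F2 by exact Hx. ring. }
  (* The equation at (i, j) is now a constant times f / x^2, and such a constant
     vanishes because f is not identically zero. *)
  intros i j. apply Rminus_diag_uniq. apply Z. intros x y Hx.
  assert (K := H i j x y Hx).
  rewrite (pd_ext i _ _ x y (F1 j) Hx) in K.
  unfold hess_rhs in K. rewrite !F1 in K by exact Hx.
  assert (K' : pd i (fun u v => / u * (b * delta j i1) * f u v) x y =
    / x * / x * f x y * (b * delta j i1 * (b * delta i i1 - delta i i1))).
  { eapply pd_eq; [derive_pd|]. cbv beta. rewrite F1 by exact Hx. ring. }
  rewrite K' in K. simpl delta in K.
  unfold half_plane in Hx. apply (Rmult_eq_reg_l (/ x * / x)).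
  - rewrite Rmult_0_r. apply Rminus_diag_eq in K. rewrite <- K. ring.
  - assert (0 < / x) by (apply Rinv_0_lt_compat, Hx). nra.
Qed.

(** * Linear isomorphisms *)

(** The Jacobian matrix of [shear a b], upper index first. *)
Definition jac (a b : R) (k i : idx) : R :=
  match k, i with i1, i1 => 1 | i1, i2 => 0 | i2, i1 => a | i2, i2 => b end.

(** The shears are linear and fix [x^1], so Christoffel symbols transform by
    the constant Jacobian matrix without a second-derivative term, and the
    factor [1 / x^1] drops out. *)
Definition intertwines (a b : R) (c c' : coeffs) : Prop := forall i j k,
  sum2 (fun p => sum2 (fun q => jac a b p i * jac a b q j * c' p q k)) =
  sum2 (fun l => jac a b k l * c i j l).

Lemma push_jac a b X k x y :
  push a b X k x y =
  sum2 (fun i => jac a b k i * X i x ((y - a * x) / b)).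
Proof.
  assert (P : forall i u v, pd i (shear a b k) u v = jac a b k i).
  { intros i u v. destruct k; unfold shear.
    - eapply pd_eq; [apply has_pd_fst|]. destruct i; reflexivity.
    - eapply pd_eq; [derive_pd|]. destruct i; simpl; ring. }
  unfold push, sum2. rewrite !P. reflexivity.
Qed.

Lemma has_pd_shear_comp a b f i x y :
  b <> 0 -> smooth f -> half_plane x y ->
  has_pd i (fun u v => f u ((v - a * u) / b)) x y
    (match i with
     | i1 => pd i1 f x ((y - a * x) / b) - a / b * pd i2 f x ((y - a * x) / b)
     | i2 => / b * pd i2 f x ((y - a * x) / b)
     end).
Proof.
  intros Hb Hs Hx.
  assert (D := smooth_differentiable f x ((y - a * x) / b) Hs Hx).
  destruct i; cbn [has_pd]; apply is_derive_Reals.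
  - replace (_ - _) with
      (pd i1 f x ((y - a * x) / b) * 1 + pd i2 f x ((y - a * x) / b) * (- a / b))
      by (field; exact Hb).
    apply (derivable_pt_lim_comp_2d f (fun u => u) (fun u => (y - a * u) / b));
      [exact D| |]; apply is_derive_Reals; auto_derive; auto; field; exact Hb.
  - replace (/ b * _) with
      (pd i1 f x ((y - a * x) / b) * 0 + pd i2 f x ((y - a * x) / b) * / b)
      by ring.
    apply (derivable_pt_lim_comp_2d f (fun u => x) (fun u => (u - a * x) / b));
      [exact D| |]; apply is_derive_Reals; auto_derive; auto; field; exact Hb.
Qed.

Lemma pd_push a b X k i x y :
  b <> 0 -> smooth_vfield half_plane X -> half_plane x y ->
  pd i (push a b X k) x y = sum2 (fun l => jac a b k l *
    match i with
     | i1 => pd i1 (X l) x ((y - a * x) / b)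
             - a / b * pd i2 (X l) x ((y - a * x) / b)
     | i2 => / b * pd i2 (X l) x ((y - a * x) / b)
     end).
Proof.
  intros Hb HX Hx.
  rewrite (pd_ext i _ _ x y (fun u v _ => push_jac a b X k u v) Hx). unfold sum2.
  eapply pd_eq.
  - apply has_pd_plus; (apply has_pd_mult;
      [apply has_pd_const | apply has_pd_shear_comp; [exact Hb | apply HX | exact Hx]]).
  - cbv beta. ring.
Qed.

(** The chain rule: directional derivatives commute with the push-forward. *)
Lemma push_directional_derivative a b X Y k x y :
  b <> 0 -> smooth_vfield half_plane Y -> half_plane x y ->
  sum2 (fun p => push a b X p x y * pd p (push a b Y k) x y) =
  sum2 (fun l => jac a b k l * sum2 (fun i =>
    X i x ((y - a * x) / b) * pd i (Y l) x ((y - a * x) / b))).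
Proof.
  intros Hb HY Hx. unfold sum2 at 1.
  rewrite !pd_push by assumption. rewrite !push_jac. unfold sum2.
  cbn [jac]. generalize (jac a b k i1) (jac a b k i2). intros u v.
  field. exact Hb.
Qed.

Lemma intertwines_isomorphic a b c c' :
  b <> 0 -> intertwines a b c c' -> linearly_isomorphic c c'.
Proof.
  intros Hb H. exists a, b. split; [exact Hb|]. intros X Y HX HY k x y Hx.
  assert (D := push_directional_derivative a b X Y k x y Hb HY Hx).
  rewrite push_jac. unfold nabla, sum2 in *.
  rewrite !Rmult_plus_distr_l, !push_jac. rewrite !push_jac in D.
  unfold typeB, sum2 in *.
  assert (H11 := H i1 i1 k). assert (H12 := H i1 i2 k).
  assert (H21 := H i2 i1 k). assert (H22 := H i2 i2 k).
  apply Rminus_diag_eq in D, H11, H12, H21, H22.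
  apply Rminus_diag_uniq.
  set (y' := (y - a * x) / b) in *.
  match type of H11 with ?h11 = 0 => match type of H12 with ?h12 = 0 =>
  match type of H21 with ?h21 = 0 => match type of H22 with ?h22 = 0 =>
  match type of D with ?d = 0 =>
    transitivity (d + / x * (X i1 x y' * (Y i1 x y' * h11 + Y i2 x y' * h12)
                       + X i2 x y' * (Y i1 x y' * h21 + Y i2 x y' * h22)));
    [|rewrite D, H11, H12, H21, H22; ring]
  end end end end end.
  unfold sum2. ring.
Qed.

(** Tested on the coordinate fields at the point [(1, 0)], where
    [1 / x^1 = 1]. *)
Lemma isomorphic_intertwines c c' :
  linearly_isomorphic c c' -> exists a b, b <> 0 /\ intertwines a b c c'.
Proof.
  intros (a & b & Hb & H). exists a, b. split; [exact Hb|]. intros i j k.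
  assert (K := H (coord i) (coord j) (smooth_coord i) (smooth_coord j) k 1 0 Rlt_0_1).
  rewrite push_jac in K. unfold nabla, sum2 in K.
  rewrite !pd_push in K by (try exact Hb; try exact Rlt_0_1; apply smooth_coord).
  rewrite !push_jac in K.
  unfold sum2 in *.
  assert (P : forall p q l u v, pd p (coord q l) u v = 0).
  { intros. apply has_pd_pd, has_pd_const. }
  rewrite !P in K. unfold typeB, coord in K. rewrite Rinv_1 in K.
  destruct i, j; simpl delta in K; lra.
Qed.

(** The components of [H f + f rho_s] for [f = (x^1)^e], up to the factor
    [(x^1)^(e - 2)]. *)
Definition power_defect (c : coeffs) (e : R) (i j : idx) : R :=
  delta i i1 * delta j i1 * (e * (e - 1)) - (c i j i1 * e - ric_s c i j).

Lemma power_exponent_defect c e :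
  power_exponent c e <-> forall i j, power_defect c e i j = 0.
Proof.
  unfold power_exponent, power_defect.
  split; intros H i j; specialize (H i j); lra.
Qed.

Lemma intertwines_solve a b c c' i j :
  b <> 0 -> intertwines a b c c' ->
  c i j i1 = sum2 (fun p => sum2 (fun q => jac a b p i * jac a b q j * c' p q i1)) /\
  c i j i2 = (sum2 (fun p => sum2 (fun q => jac a b p i * jac a b q j * c' p q i2))
    - a * sum2 (fun p => sum2 (fun q => jac a b p i * jac a b q j * c' p q i1))) / b.
Proof.
  intros Hb H. rewrite !H. unfold sum2. cbn [jac]. split; [ring|field; exact Hb].
Qed.

(** The tensor [H f + f rho_s] is natural, and [f = (x^1)^e] is invariant under
    the shears. *)
Lemma power_defect_tensor a b c c' e i j :
  b <> 0 -> sym_coeffs c' -> intertwines a b c c' ->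
  power_defect c e i j =
  sum2 (fun p => sum2 (fun q => jac a b p i * jac a b q j * power_defect c' e p q)).
Proof.
  intros Hb Hc' H.
  unfold power_defect, ric_s, ric, curv_coeff, sum2.
  destruct i, j; cbn [jac delta];
  repeat match goal with |- context [c ?i ?j i1] =>
    rewrite (proj1 (intertwines_solve a b c c' i j Hb H)) end;
  repeat match goal with |- context [c ?i ?j i2] =>
    rewrite (proj2 (intertwines_solve a b c c' i j Hb H)) end;
  unfold sum2; cbn [jac]; rewrite !(Hc' i2 i1); field; exact Hb.
Qed.

(** The skew part of the Ricci tensor is a 2-form, which scales by the
    determinant [b] of the Jacobian matrix. *)
Lemma ricci_skew_intertwines a b c c' :
  b <> 0 -> sym_coeffs c' -> intertwines a b c c' ->
  ricci_skew c = b * ricci_skew c'.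
Proof.
  intros Hb Hc' H. unfold ricci_skew.
  rewrite (proj1 (intertwines_solve a b c c' i1 i2 Hb H)).
  rewrite (proj2 (intertwines_solve a b c c' i2 i2 Hb H)).
  unfold sum2; cbn [jac]. rewrite (Hc' i2 i1). field. exact Hb.
Qed.

Lemma power_exponent_intertwines a b c c' e :
  b <> 0 -> sym_coeffs c' -> intertwines a b c c' ->
  (power_exponent c e <-> power_exponent c' e).
Proof.
  intros Hb Hc' H. rewrite !power_exponent_defect.
  assert (T := fun i j => power_defect_tensor a b c c' e i j Hb Hc' H).
  unfold sum2 in T. split; intros Z.
  (* The Jacobian matrix is triangular, so the components vanish in turn,
     starting with (2, 2). *)
  - assert (Z11 := T i1 i1). assert (Z12 := T i1 i2).
    assert (Z21 := T i2 i1). assert (Z22 := T i2 i2).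
    rewrite Z in Z11, Z12, Z21, Z22. cbn [jac] in *.
    assert (D22 : power_defect c' e i2 i2 = 0).
    { apply (Rmult_eq_reg_l (b * b)); [lra|nra]. }
    rewrite D22 in *.
    assert (D12 : power_defect c' e i1 i2 = 0).
    { apply (Rmult_eq_reg_l b); lra. }
    assert (D21 : power_defect c' e i2 i1 = 0).
    { apply (Rmult_eq_reg_l b); lra. }
    rewrite D12, D21 in *.
    intros [] []; lra.
  - intros i j. rewrite T, !Z. ring.
Qed.

(** [jac (- a / b) (/ b)] is the inverse of [jac a b]. *)
Definition transport (a b : R) (c : coeffs) : coeffs := fun p q k =>
  sum2 (fun l => jac a b k l * sum2 (fun i => sum2 (fun j =>
    jac (- a / b) (/ b) i p * jac (- a / b) (/ b) j q * c i j l))).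

Lemma transport_sym a b c : sym_coeffs c -> sym_coeffs (transport a b c).
Proof.
  intros Hc p q k. unfold transport, sum2. rewrite !(Hc i2 i1). ring.
Qed.

Lemma transport_intertwines a b c :
  b <> 0 -> intertwines a b c (transport a b c).
Proof.
  intros Hb i j k. unfold transport, sum2.
  destruct i, j; cbn [jac]; field; exact Hb.
Qed.

(** * Normal forms *)

Lemma case1_power c :
  sym_coeffs c -> case1 c ->
  power_exponent c (c i1 i2 i2) /\ ricci_skew c <> 0.
Proof.
  intros Hc (H1 & H2 & H3). split.
  - intros i j. unfold ric_s, ric, curv_coeff, sum2.
    destruct i, j; cbn [delta]; rewrite ?(Hc i2 i1), ?H1, ?H2; field.
  - unfold ricci_skew. lra.
Qed.

Lemma case2_power s c :
  sym_coeffs c -> (s = 1 \/ s = -1) -> case2 s c ->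
  power_exponent c (s * c i1 i1 i2 ^ 2 + c i1 i2 i2) /\ ricci_skew c <> 0.
Proof.
  intros Hc Hs (H1 & H2 & H3 & H4 & H5). split.
  - intros i j. unfold ric_s, ric, curv_coeff, sum2.
    destruct i, j; cbn [delta]; rewrite ?(Hc i2 i1), ?H1, ?H2, ?H3, ?H5;
      destruct Hs as [-> | ->]; field.
  - unfold ricci_skew. lra.
Qed.

(** With [C_22^1 = 0], the (2, 2) equation is
    [C_12^1 (C_22^2 - C_12^1) = 0].  The factor [C_12^1] cannot vanish, since
    then the (1, 2) equation gives [C_22^2 = 0] and the Ricci tensor is
    symmetric. *)
Lemma power_case1 c e :
  sym_coeffs c -> power_exponent c e -> ricci_skew c <> 0 ->
  c i2 i2 i1 = 0 -> case1 c.
Proof.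
  intros Hc He Ha H1. unfold ricci_skew in Ha.
  assert (R12 := He i1 i2). assert (R22 := He i2 i2).
  unfold ric_s, ric, curv_coeff, sum2 in R12, R22. cbn [delta] in *.
  rewrite !(Hc i2 i1) in *. rewrite H1 in *.
  assert (P : c i1 i2 i1 * (c i2 i2 i2 - c i1 i2 i1) = 0) by lra.
  apply Rmult_integral in P. destruct P as [P|P].
  - exfalso. rewrite P in *. apply Ha. lra.
  - repeat split; lra.
Qed.

(** The (1, 2) equation determines [C_22^2], the (2, 2) equation the exponent,
    and with these the (1, 1) equation determines [C_11^1]. *)
Lemma power_case2 s c e :
  sym_coeffs c -> power_exponent c e -> ricci_skew c <> 0 ->
  (s = 1 \/ s = -1) -> c i2 i2 i1 = s -> c i1 i2 i1 = 0 -> case2 s c.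
Proof.
  intros Hc He Ha Hs H1 H2. unfold ricci_skew in Ha.
  assert (R11 := He i1 i1). assert (R12 := He i1 i2). assert (R22 := He i2 i2).
  unfold ric_s, ric, curv_coeff, sum2 in R11, R12, R22. cbn [delta] in *.
  rewrite !(Hc i2 i1) in *. rewrite H1, H2 in *.
  assert (H3 : c i2 i2 i2 = s * 2 * c i1 i1 i2) by lra.
  assert (Ee : e = c i1 i1 i1 - c i1 i2 i2 - 1).
  { destruct Hs as [-> | ->]; lra. }
  rewrite H3 in *.
  repeat split; try assumption; try lra.
  rewrite Ee in R11. lra.
Qed.

Lemma power_normal_form c e :
  sym_coeffs c -> power_exponent c e -> ricci_skew c <> 0 ->
  exists c', sym_coeffs c' /\ linearly_isomorphic c c' /\
    (case1 c' \/ exists s, (s = 1 \/ s = -1) /\ case2 s c').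
Proof.
  intros Hc He Ha. destruct (Req_dec (c i2 i2 i1) 0) as [H0|H0].
  - exists c. split; [exact Hc|]. split; [|left; eapply power_case1; eassumption].
    apply intertwines_isomorphic with 0 1; [lra|].
    intros i j k. unfold sum2. destruct i, j, k; cbn [jac]; ring.
  (* The shear divides C_22^1 by b^2, whence b; then a kills C_12^1. *)
  - set (f := c i2 i2 i1) in *. set (b := sqrt (Rabs f)).
    assert (Hb : 0 < b) by (apply sqrt_lt_R0, Rabs_pos_lt, H0).
    assert (Hbb : b * b = Rabs f) by (apply sqrt_sqrt, Rabs_pos).
    assert (b0 : b <> 0) by lra.
    set (a := b * c i1 i2 i1 / f).
    assert (T := transport_intertwines a b c b0).
    exists (transport a b c).
    split; [apply transport_sym, Hc|].
    split; [apply intertwines_isomorphic with a b; assumption|].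
    right. exists (f / Rabs f).
    assert (Hs : f / Rabs f = 1 \/ f / Rabs f = -1).
    { unfold Rabs. destruct (Rcase_abs f); [right|left]; field; exact H0. }
    split; [exact Hs|].
    apply power_case2 with e; try exact Hs.
    + apply transport_sym, Hc.
    + apply (power_exponent_intertwines a b c); auto using transport_sym.
    + intros K. apply Ha.
      rewrite (ricci_skew_intertwines a b c _ b0 (transport_sym a b c Hc) T).
      rewrite K. ring.
    + rewrite <- Hbb. unfold transport, sum2. cbn [jac].
      fold f. field. exact b0.
    + unfold transport, sum2. cbn [jac]. fold f. unfold a. field. auto.
Qed.

Theorem theorem5p9 :
  forall c : coeffs, sym_coeffs c ->
  dim_killing (typeB c) 2 ->
  ~ strongly_projectively_flat (typeB c) ->
  (dim_E (-1) (typeB c) 1 <->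
   exists c' : coeffs, sym_coeffs c' /\ linearly_isomorphic c c' /\
     (case1 c' \/ exists s : R, (s = 1 \/ s = -1) /\ case2 s c'))
  /\
  (forall c' : coeffs, sym_coeffs c' -> linearly_isomorphic c c' ->
   case1 c' ->
   E_is_span (-1) (typeB c) (fun x _ => Rpower x (c' i1 i2 i2)) /\
   E_is_span (-1) (typeB c') (fun x _ => Rpower x (c' i1 i2 i2)))
  /\
  (forall (c' : coeffs) (s : R), sym_coeffs c' -> linearly_isomorphic c c' ->
   (s = 1 \/ s = -1) -> case2 s c' ->
   E_is_span (-1) (typeB c)
     (fun x _ => Rpower x (s * (c' i1 i1 i2) ^ 2 + c' i1 i2 i2)) /\
   E_is_span (-1) (typeB c')
     (fun x _ => Rpower x (s * (c' i1 i1 i2) ^ 2 + c' i1 i2 i2))).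
Proof.
  intros c Hc _ Hflat.
  assert (S : forall c' e, sym_coeffs c' -> linearly_isomorphic c c' ->
    power_exponent c' e /\ ricci_skew c' <> 0 ->
    E_is_span (-1) (typeB c) (fun x _ => Rpower x e) /\
    E_is_span (-1) (typeB c') (fun x _ => Rpower x e)).
  { intros c' e Hc' L [He Ha].
    destruct (isomorphic_intertwines c c' L) as (a & b & Hb & T).
    split; [|apply E_span_power; assumption].
    apply E_span_power; [exact Hc| |].
    - apply (power_exponent_intertwines a b c c'); assumption.
    - rewrite (ricci_skew_intertwines a b c c') by assumption.
      apply Rmult_integral_contrapositive_currified; assumption. }
  assert (S1 : forall c', sym_coeffs c' -> linearly_isomorphic c c' -> case1 c' ->
    E_is_span (-1) (typeB c) (fun x _ => Rpower x (c' i1 i2 i2)) /\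
    E_is_span (-1) (typeB c') (fun x _ => Rpower x (c' i1 i2 i2))).
  { intros c' Hc' L H. apply S; auto. apply case1_power; assumption. }
  assert (S2 : forall c' s, sym_coeffs c' -> linearly_isomorphic c c' ->
    (s = 1 \/ s = -1) -> case2 s c' ->
    E_is_span (-1) (typeB c)
      (fun x _ => Rpower x (s * (c' i1 i1 i2) ^ 2 + c' i1 i2 i2)) /\
    E_is_span (-1) (typeB c')
      (fun x _ => Rpower x (s * (c' i1 i1 i2) ^ 2 + c' i1 i2 i2))).
  { intros c' s Hc' L Hs H. apply S; auto. apply case2_power; assumption. }
  split; [split|split].
  - intros Hdim. destruct (power_exponent_of_dim c Hdim) as [e He].
    apply power_normal_form with e; [exact Hc|exact He|].
    intros Ha. apply Hflat.
    apply strongly_projectively_flat_of_power with e; assumption.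
  - intros (c' & Hc' & L & [H | (s & Hs & H)]); eapply dim_E_of_span.
    + exact (proj1 (S1 c' Hc' L H)).
    + exact (proj1 (S2 c' s Hc' L Hs H)).
  - exact S1.
  - exact S2.
Qed.
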